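(* Let $(A,\mathcal{M})$ be a commutative Noetherian local ring with maximal ideal $\mathcal{M}$, let $I$ and $J$ be ideals of $A$ and let $a\in A$. If $(I\cap J)+aA$ is $\mathcal{M}$-primary, the following formula holds: $$\operatorname{length}_A(K_a^{I\cap J})-\operatorname{length}_A(K_a^{I})-\operatorname{length}_A(K_a^{J})+\operatorname{length}_A(K_a^{I+J})$$ $$=\operatorname{length}_A(C_a^{I\cap J})-\operatorname{length}_A(C_a^{I})-\operatorname{length}_A(C_a^{J})+\operatorname{length}_A(C_a^{I+J}).$$
   Context: For an ideal $L$ of $A$ and $a\in A$, $\mu_a^L\colon A/L\to A/L$ is the $A$-module homomorphism $x+L\mapsto ax+L$. Its kernel is $K_a^L:=\ker(\mu_a^L)=(L:a)/L$, where $(L:a)=\{x\in A\mid ax\in L\}$, and its cokernel is $C_a^L:=\operatorname{coker}(\mu_a^L)\cong A/(L+aA)$. $\operatorname{length}_A$ denotes the length of an $A$-module. *)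

(* Defs.v *)
From HB Require Import structures.
From mathcomp Require Import all_boot all_order all_algebra.
From mathcomp Require Import all_classical all_reals.

Set Implicit Arguments.
Unset Strict Implicit.
Unset Printing Implicit Defensive.

Import Order.TTheory GRing.Theory Num.Theory.
Local Open Scope ring_scope.
Local Open Scope quotient_scope.

(* Submodules are MathComp's bundled boolean predicates [submodClosed V].
   Since [asbool] turns every proposition into a boolean, these are all the
   submodules, not only the decidable ones. *)

Section Submodules.
Context {R : pzRingType} {V : lmodType R}.
Implicit Types N P : submodClosed V.

Definition cap_submod N P : {pred V} := [pred x | (x \in N) && (x \in P)].

Lemma cap_submod_closed N P : submod_closed (cap_submod N P).
Proof.
split=> [|a x y]; rewrite !inE ?rpred0 // => /andP[xN xP] /andP[yN yP].
by rewrite !rpredD ?rpredZ.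
Qed.
HB.instance Definition _ N P :=
  GRing.isSubmodClosed.Build R V (cap_submod N P) (cap_submod_closed N P).

Definition add_submod N P : {pred V} :=
  [pred x | `[< exists y z, [/\ y \in N, z \in P & x = y + z] >]].

Lemma add_submod_closed N P : submod_closed (add_submod N P).
Proof.
split=> [|a x y]; first by apply/asboolP; exists 0, 0; rewrite !rpred0 addr0.
move=> /asboolP[x1 [x2 [x1N x2P ->]]] /asboolP[y1 [y2 [y1N y2P ->]]].
apply/asboolP; exists (a *: x1 + y1), (a *: x2 + y2).
by rewrite !rpredD ?rpredZ // scalerDr addrACA.
Qed.
HB.instance Definition _ N P :=
  GRing.isSubmodClosed.Build R V (add_submod N P) (add_submod_closed N P).

Definition proper_submod N P : Prop :=
  {subset N <= P} /\ ~ {subset P <= N}.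

End Submodules.

Section SubmoduleType.
Context {R : pzRingType} {V : lmodType R} (N : submodClosed V).

Definition submod_type : Type := {x : V | x \in N}.

HB.instance Definition _ := SubChoice.on submod_type.
HB.instance Definition _ := [SubChoice_isSubLmodule of submod_type by <:].

End SubmoduleType.

Section QuotientModule.
Context {R : pzRingType} {V : lmodType R} (N : submodClosed V).

(* [submodClosed] does not inherit from [zmodClosed], which the library
   requires for quotients. *)
Definition zmod_of_submod : {pred V} := N.

Lemma zmod_of_submod_closed : zmod_closed zmod_of_submod.
Proof. exact: (submodClosedP N : zmod_closed _). Qed.
HB.instance Definition _ :=
  GRing.isZmodClosed.Build V zmod_of_submod zmod_of_submod_closed.

Definition quot_mod : Type := Quotient.quot zmod_of_submod.

HB.instance Definition _ := GRing.Zmodule.on quot_mod.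

Definition to_quot (x : V) : quot_mod := \pi_(Quotient.quot zmod_of_submod) x.

Definition quot_scale (a : R) (x : quot_mod) : quot_mod :=
  to_quot (a *: repr x).

Lemma to_quotK (x : quot_mod) : to_quot (repr x) = x.
Proof. exact: reprK. Qed.

Lemma to_quot_eq (x y : V) : to_quot x = to_quot y <-> x - y \in N.
Proof.
by split=> [/eqP|h]; [|apply/eqP];
  rewrite -(Quotient.idealrBE zmod_of_submod).
Qed.

Lemma to_quotD (x y : V) : to_quot (x + y) = to_quot x + to_quot y.
Proof. exact: (raddfD \pi_(Quotient.quot zmod_of_submod)). Qed.

Lemma quot_scaleE a x : quot_scale a (to_quot x) = to_quot (a *: x).
Proof.
apply/to_quot_eq; rewrite -scalerBr rpredZ //.
by apply/to_quot_eq; exact: to_quotK.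
Qed.

Lemma quot_scaleA a b x :
  quot_scale a (quot_scale b x) = quot_scale (a * b) x.
Proof. by rewrite -[x]to_quotK !quot_scaleE scalerA. Qed.

Lemma quot_scale1 : left_id 1 quot_scale.
Proof. by move=> x; rewrite -[x]to_quotK quot_scaleE scale1r. Qed.

Lemma quot_scaleDr : right_distributive quot_scale +%R.
Proof.
move=> a x y; rewrite -[x]to_quotK -[y]to_quotK -to_quotD !quot_scaleE.
by rewrite scalerDr to_quotD.
Qed.

Lemma quot_scaleDl x : {morph quot_scale^~ x : a b / a + b}.
Proof.
by move=> a b /=; rewrite -[x]to_quotK !quot_scaleE scalerDl to_quotD.
Qed.

HB.instance Definition _ := GRing.Zmodule_isLmodule.Build R quot_mod
  quot_scaleA quot_scale1 quot_scaleDr quot_scaleDl.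

Lemma to_quot_is_linear : linear to_quot.
Proof. by move=> a x y; rewrite to_quotD -quot_scaleE. Qed.
HB.instance Definition _ :=
  GRing.isLinear.Build R V quot_mod _ to_quot to_quot_is_linear.

End QuotientModule.

Section KernelCokernel.
Context {R : pzRingType} {U V : lmodType R} (f : {linear U -> V}).

Definition ker_submod : {pred U} := [pred x | f x == 0].

Lemma ker_submod_closed : submod_closed ker_submod.
Proof.
split=> [|a x y]; rewrite !inE ?linear0 // => /eqP fx /eqP fy.
by rewrite linearP fx fy scaler0 addr0.
Qed.
HB.instance Definition _ :=
  GRing.isSubmodClosed.Build R U ker_submod ker_submod_closed.

Definition im_submod : {pred V} := [pred y | `[< exists x, y = f x >]].

Lemma im_submod_closed : submod_closed im_submod.
Proof.
split=> [|a x y]; first by apply/asboolP; exists 0; rewrite linear0.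
move=> /asboolP[u ->] /asboolP[v ->].
by apply/asboolP; exists (a *: u + v); rewrite linearP.
Qed.
HB.instance Definition _ :=
  GRing.isSubmodClosed.Build R V im_submod im_submod_closed.

Definition ker_mod : lmodType R := submod_type ker_submod.
Definition coker_mod : lmodType R := quot_mod im_submod.

End KernelCokernel.

Section Length.
Context {R : pzRingType}.

Definition has_chain (V : lmodType R) (n : nat) : Prop :=
  exists c : nat -> submodClosed V,
    forall i, (i < n)%N -> proper_submod (c i) (c i.+1).

(* The supremum of the lengths of strict chains of submodules: [xget]
   returns the largest such length if there is one, and +oo otherwise. *)
Definition module_length (V : lmodType R) : \bar int :=
  xget +oo%E [set n%:Z%:E | n in
    [set n : nat | has_chain V n /\ forall m, has_chain V m -> (m <= n)%N]].

End Length.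

(* Unlike the library's [idealr], this includes the unit ideal. *)
Notation ideal A := (submodClosed A^o).

Section Ideals.
Context {A : comNzRingType}.
Implicit Types I L M Q : ideal A.

Definition principal (a : A) : {pred A^o} :=
  [pred x | `[< exists y : A, x = a * y >]].

Lemma principal_closed a : submod_closed (principal a).
Proof.
split=> [|b x y]; first by apply/asboolP; exists 0; rewrite mulr0.
move=> /asboolP[u ->] /asboolP[v ->]; apply/asboolP; exists (b * u + v).
by rewrite mulrDr mulrCA.
Qed.
HB.instance Definition _ a :=
  GRing.isSubmodClosed.Build A A^o (principal a) (principal_closed a).

Definition maximal_ideal M : Prop :=
  (1 : A) \notin M /\
  forall L, {subset M <= L} -> (1 : A) \notin L -> {subset L <= M}.

Definition primary_ideal Q : Prop :=
  (1 : A) \notin Q /\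
  forall x y : A, x * y \in Q -> x \in Q \/ exists n, y ^+ n.+1 \in Q.

Definition primary_to M Q : Prop :=
  primary_ideal Q /\ forall x : A, x \in M <-> exists n, x ^+ n.+1 \in Q.

Definition mu (a : A) (L : ideal A) (x : quot_mod L) : quot_mod L := a *: x.

Lemma muE a L (x : A) : mu a (to_quot L x) = to_quot L (a * x).
Proof. by rewrite /mu -linearZ. Qed.

Lemma mu_is_linear a L : linear (@mu a L).
Proof. by move=> b x y; rewrite /mu scalerDr !scalerA mulrC. Qed.
HB.instance Definition _ a L :=
  GRing.isLinear.Build A (quot_mod L) (quot_mod L) _ (@mu a L)
    (mu_is_linear a (L := L)).

Definition K_mod (a : A) (L : ideal A) : lmodType A := ker_mod (@mu a L).
Definition C_mod (a : A) (L : ideal A) : lmodType A := coker_mod (@mu a L).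

End Ideals.

Definition noetherian (A : comNzRingType) : Prop :=
  forall L : ideal A, exists n (g : 'I_n -> A),
    forall x : A, x \in L <-> exists c : 'I_n -> A, x = \sum_i c i * g i.

Definition local_ring (A : comNzRingType) (M : ideal A) : Prop :=
  maximal_ideal M /\ forall N : ideal A, maximal_ideal N -> N =i M.

(* Main.v *)
(* Write N = I \cap J, S = I + J, B = aA, and work with lengths of intervals of
   ideals of A: K_a^L is the interval [L, (L:a)] and C_a^L is [L + B, A].
   In a modular lattice, the lengths of [I, P] and [J, Q] add up to those of
   [I \cap J, P \cap Q] and [I + J, P + Q].  Applied to the kernels, where
   (N:a) = (I:a) \cap (J:a), and to the cokernels, this reduces the formula to
   the equality of the lengths of the two defects [(I:a) + (J:a), (S:a)] and
   [N + B, (I + B) \cap (J + B)].  Multiplication by a identifies the first with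
   [(B \cap I) + (B \cap J), B \cap S], which is projective to the second in the
   modular lattice generated by I, J and B.
   All lengths are finite because N + B contains a power of each element of M
   and multiplies (L:a) into L and A into L + B. *)
From HB Require Import structures.
Require Import Defs.
From mathcomp Require Import all_boot all_order all_algebra.
From mathcomp Require Import zify ring.
From mathcomp Require Import all_classical all_reals.
Set Implicit Arguments.
Unset Strict Implicit.
Unset Printing Implicit Defensive.

Import Order.TTheory GRing.Theory Num.Theory.
Local Open Scope ring_scope.

(** * The modular lattice of submodules *)

Section SubmoduleLattice.
Context {R : pzRingType} {V : lmodType R}.
Implicit Types N P Q X Y : submodClosed V.

Lemma submodB N x y : x \in N -> y \in N -> x - y \in N.
Proof. by move=> xN yN; rewrite -scaleN1r rpredD ?rpredZ. Qed.

Lemma mem_cap_submod N P x : (x \in cap_submod N P) = (x \in N) && (x \in P).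
Proof. by []. Qed.

Lemma add_submodP N P x :
  reflect (exists y z, [/\ y \in N, z \in P & x = y + z])
          (x \in add_submod N P).
Proof. exact: asboolP. Qed.

Lemma mem_add_submod N P y z :
  y \in N -> z \in P -> y + z \in add_submod N P.
Proof. by move=> yN zP; apply/add_submodP; exists y, z. Qed.

Lemma cap_subl N P : {subset cap_submod N P <= N}.
Proof. by move=> x /andP[]. Qed.

Lemma cap_subr N P : {subset cap_submod N P <= P}.
Proof. by move=> x /andP[]. Qed.

Lemma sub_cap N P Q :
  {subset Q <= N} -> {subset Q <= P} -> {subset Q <= cap_submod N P}.
Proof. by move=> QN QP x xQ; rewrite mem_cap_submod QN ?QP. Qed.

Lemma cap_submodS N N' P P' : {subset N <= N'} -> {subset P <= P'} ->
  {subset cap_submod N P <= cap_submod N' P'}.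
Proof. by move=> NN PP x /andP[xN xP]; rewrite mem_cap_submod NN ?PP. Qed.

Lemma add_subl N P : {subset N <= add_submod N P}.
Proof. by move=> x xN; rewrite -[x]addr0 mem_add_submod ?rpred0. Qed.

Lemma add_subr N P : {subset P <= add_submod N P}.
Proof. by move=> x xP; rewrite -[x]add0r mem_add_submod ?rpred0. Qed.

Lemma add_sub N P Q :
  {subset N <= Q} -> {subset P <= Q} -> {subset add_submod N P <= Q}.
Proof.
by move=> NQ PQ x /add_submodP[y [z [/NQ yQ /PQ zQ ->]]]; rewrite rpredD.
Qed.

Lemma add_submodS N N' P P' : {subset N <= N'} -> {subset P <= P'} ->
  {subset add_submod N P <= add_submod N' P'}.
Proof.
move=> NN PP x /add_submodP[y [z [/NN yN /PP zP ->]]].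
exact: mem_add_submod.
Qed.

Lemma add_submodC N P : add_submod N P =i add_submod P N.
Proof.
by move=> x; apply/add_submodP/add_submodP => -[y [z [yN zP ->]]];
  exists z, y; rewrite addrC.
Qed.

Lemma cap_submodC N P : cap_submod N P =i cap_submod P N.
Proof. by move=> x; rewrite !mem_cap_submod andbC. Qed.

Lemma modular_law N P Q : {subset N <= Q} ->
  cap_submod (add_submod N P) Q =i add_submod N (cap_submod P Q).
Proof.
move=> NQ x; rewrite mem_cap_submod; apply/andP/add_submodP.
  move=> [/add_submodP[y [z [yN zP ->]]] xQ]; exists y, z.
  split=> //; rewrite mem_cap_submod zP -[z](addrK y) [z + y]addrC.
  by rewrite submodB // NQ.
move=> [y [z [yN /andP[zP zQ] ->]]]; rewrite mem_add_submod //.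
by rewrite rpredD // NQ.
Qed.

Lemma sub_eqi N P : {subset N <= P} -> {subset P <= N} -> N =i P.
Proof. by move=> NP PN x; apply/idP/idP => [/NP|/PN]. Qed.

Definition full_submod : {pred V} := predT.
Lemma full_submod_closed : submod_closed full_submod. Proof. by []. Qed.
HB.instance Definition _ :=
  GRing.isSubmodClosed.Build R V full_submod full_submod_closed.

Definition zero_submod : {pred V} := pred1 0.
Lemma zero_submod_closed : submod_closed zero_submod.
Proof.
split=> [|a x y]; rewrite !inE // => /eqP-> /eqP->.
by rewrite scaler0 addr0.
Qed.
HB.instance Definition _ :=
  GRing.isSubmodClosed.Build R V zero_submod zero_submod_closed.

End SubmoduleLattice.

(** * Strict chains in an interval of submodules *)

Section Chains.
Context {R : pzRingType} {V : lmodType R}.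
Implicit Types N P Q X Y : submodClosed V.

Lemma proper_submod_subl N' N P :
  {subset N' <= N} -> proper_submod N P -> proper_submod N' P.
Proof.
move=> N'N [NP PN]; split=> [x /N'N/NP //|PN']; apply: PN => x /PN'.
exact: N'N.
Qed.

Lemma not_proper_submod N P :
  {subset N <= P} -> ~ proper_submod N P -> {subset P <= N}.
Proof. by move=> NP nNP; apply: contrapT => PN; apply: nNP. Qed.

(** The [n] strict steps start at [N], but the last link to [P] is a mere inclusion, so a chain
    survives enlarging the interval at either end and can be truncated. *)
Fixpoint chain (n : nat) N P : Prop :=
  if n is n'.+1 then exists2 Q, proper_submod N Q & chain n' Q P
  else {subset N <= P}.

Lemma chain_sub n N P : chain n N P -> {subset N <= P}.
Proof.
elim: n N => //= n IHn N [Q [NQ _] /IHn QP] x /NQ; exact: QP.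
Qed.

Lemma chain_widen n N N' P P' : {subset N' <= N} -> {subset P <= P'} ->
  chain n N P -> chain n N' P'.
Proof.
elim: n N N' => [|n IHn] N N' N'N PP' /=.
  by move=> NP x /N'N/NP/PP'.
move=> [Q NQ QP]; exists Q; first exact: proper_submod_subl NQ.
exact: IHn QP.
Qed.

Lemma chain_leq m n N P : (m <= n)%N -> chain n N P -> chain m N P.
Proof.
elim: m n N => [|m IHm] [|n] N //= mn; first by move/(@chain_sub n.+1).
by move=> [Q NQ QP]; exists Q => //; apply: IHm QP.
Qed.

Lemma chain_cat m n N P Q : chain m N P -> chain n P Q -> chain (m + n) N Q.
Proof.
elim: m N => [|m IHm] N /=; first by move=> NP; apply: chain_widen.
by move=> [X NX XP] PQ; exists X => //; apply: IHm.
Qed.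

Lemma chain_same n N P : {subset P <= N} -> chain n N P -> n = 0%N.
Proof.
case: n => //= n PN [Q [_ QN] /chain_sub QP].
by exfalso; apply: QN => x /QP/PN.
Qed.

(* By modularity each strict step of a chain stays strict in the trace on Q
   or in the sum with Q. *)
Lemma chain_split k N P Q : chain k N P ->
  exists m n, [/\ (k <= m + n)%N, chain m (cap_submod N Q) (cap_submod P Q)
                & chain n (add_submod N Q) (add_submod P Q)].
Proof.
elim: k N => [|k IHk] N /=.
  move=> NP; exists 0%N, 0%N; split=> //=.
    exact: cap_submodS.
  exact: add_submodS.
move=> [X [NX XN] /IHk[m [n [kmn Xm Xn]]]].
have cNX : {subset cap_submod N Q <= cap_submod X Q} by apply: cap_submodS.
have aNX : {subset add_submod N Q <= add_submod X Q} by apply: add_submodS.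
have [cp|ncp] := pselect (proper_submod (cap_submod N Q) (cap_submod X Q)).
  exists m.+1, n; split; rewrite ?addSn //.
    by exists (cap_submod X Q : submodClosed V).
  exact: chain_widen Xn.
have [ap|nap] := pselect (proper_submod (add_submod N Q) (add_submod X Q)).
  exists m, n.+1; split; rewrite ?addnS //.
    exact: chain_widen Xm.
  by exists (add_submod X Q : submodClosed V).
(* If [N] and [X] have the same trace on [Q] and the same sum with [Q], then [x = y + z] with [y] in
   [N] and [z] in [Q]; here [z = x - y] lies in the common trace, so [x] is in [N]. *)
have cXN := not_proper_submod cNX ncp; have aXN := not_proper_submod aNX nap.
exfalso; apply: XN => x xX.
have /add_submodP[y [z [yN zQ xyz]]] : x \in add_submod N Q.
  exact/aXN/add_subl.
have zE : z = x - y by rewrite xyz [y + z]addrC addrK.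
rewrite xyz rpredD //; apply/(@cap_subl _ _ N Q)/cXN.
by rewrite mem_cap_submod zQ andbT zE submodB ?(NX _ yN).
Qed.

(** This is the second isomorphism theorem for intervals. Splitting a chain along the other
    submodule leaves one of the two pieces in a trivial interval, so all the strict steps go to the
    other piece. *)
Lemma chain_transpose n P Q :
  chain n (cap_submod P Q) P <-> chain n Q (add_submod P Q).
Proof.
split=> [/(@chain_split _ _ _ Q)|/(@chain_split _ _ _ P)] [k [l [nkl kc lc]]].
  have k0 : k = 0%N by apply: chain_same kc; apply: sub_cap => // x /cap_subr.
  rewrite k0 add0n in nkl; apply: chain_leq nkl _.
  by apply: chain_widen lc => //; apply: add_subr.
have l0 : l = 0%N.
  apply: chain_same lc; apply: add_sub; last exact: add_subr.
  by move=> x; rewrite add_submodC.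
rewrite l0 addn0 in nkl; apply: chain_leq nkl _.
by apply: chain_widen kc => [x|]; [rewrite cap_submodC|apply: cap_subr].
Qed.

Definition fin_len N P := exists n, forall m, chain m N P -> (m <= n)%N.

Definition is_len N P n := chain n N P /\ forall m, chain m N P -> (m <= n)%N.

(* Junk value 0 on intervals of infinite length. *)
Definition len N P : nat := xget 0%N [set n | is_len N P n].

End Chains.

(** Comparing chain lengths transfers finiteness and length together, so the isomorphisms below are
    only ever stated for [chain n]. The two intervals may live in different modules. *)
Lemma len_same_chains (R : pzRingType) (U V : lmodType R) (N P : submodClosed U)
    (N' P' : submodClosed V) :
  (forall n, chain n N P <-> chain n N' P') ->
  (fin_len N P <-> fin_len N' P') /\ len N P = len N' P'.
Proof.
move=> E; split.
  by split=> -[b bP]; exists b => m /E/bP.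
rewrite /len; congr (xget _ _); apply/funext => n; apply/propext.
by split=> -[nc nmax]; split; by [exact/E|move=> m /E/nmax].
Qed.

(** * Finite length and its additivity *)

Section Length.
Context {R : pzRingType} {V : lmodType R}.
Implicit Types N P Q : submodClosed V.

Lemma lenP N P : {subset N <= P} -> fin_len N P -> is_len N P (len N P).
Proof.
move=> NP [b bP]; apply: (@xgetPex _ 0%N [set n | is_len N P n]).
have ex : exists n, `[< chain n N P >] by exists 0%N; apply/asboolP.
have ub n : `[< chain n N P >] -> (n <= b)%N by move/asboolP; apply: bP.
case: (ex_maxnP ex ub) => n /asboolP nc nmax; exists n; split=> // m mc.
by apply: nmax; apply/asboolP.
Qed.

Lemma len_unique N P n : is_len N P n -> len N P = n.
Proof.
move=> [nc nmax]; apply: xget_unique => [//|m [mc mmax]].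
by apply/eqP; rewrite eqn_leq nmax ?mmax.
Qed.

Lemma fin_len_sub N N' P P' : {subset N <= N'} -> {subset P' <= P} ->
  fin_len N P -> fin_len N' P'.
Proof.
by move=> NN PP [b bP]; exists b => m mc; apply: bP; apply: chain_widen mc.
Qed.

Lemma fin_len_trans N P Q : {subset N <= P} -> {subset P <= Q} ->
  fin_len N P -> fin_len P Q -> fin_len N Q.
Proof.
move=> NP PQ [b bP] [c cP]; exists (b + c)%N => k.
move=> /(chain_split P)[m [n [kmn mc nc]]]; apply: leq_trans kmn _.
apply: leq_add.
  by apply: bP; apply: chain_widen mc; [apply: sub_cap|apply: cap_subr].
by apply: cP; apply: chain_widen nc; [apply: add_subr|apply: add_sub].
Qed.

Lemma len_add N P Q : {subset N <= P} -> {subset P <= Q} -> fin_len N Q ->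
  len N Q = (len N P + len P Q)%N.
Proof.
move=> NP PQ fNQ.
have [pc pm] : is_len N P (len N P).
  by apply: lenP => //; apply: fin_len_sub fNQ.
have [qc qm] : is_len P Q (len P Q).
  by apply: lenP => //; apply: fin_len_sub fNQ.
apply: len_unique; split; first exact: chain_cat qc.
move=> k /(chain_split P)[m [n [kmn mc nc]]]; apply: leq_trans kmn _.
apply: leq_add.
  by apply: pm; apply: chain_widen mc; [apply: sub_cap|apply: cap_subr].
by apply: qm; apply: chain_widen nc; [apply: add_subr|apply: add_sub].
Qed.

Lemma len_congr N N' P P' : N =i N' -> P =i P' -> len N P = len N' P'.
Proof.
move=> NN PP; apply: (len_same_chains _).2 => n.
by split; apply: chain_widen => x; rewrite ?NN ?PP.
Qed.

End Length.

(** * Chains under images and preimages of linear maps *)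

Section ImagePreimage.
Context {R : pzRingType} {U V : lmodType R} (f : {linear U -> V}).
Implicit Types (N P : submodClosed U) (X Y : submodClosed V).

Definition image_submod N : {pred V} :=
  [pred y | `[< exists2 x, x \in N & y = f x >]].

Lemma image_submodP N y :
  reflect (exists2 x, x \in N & y = f x) (y \in image_submod N).
Proof. exact: asboolP. Qed.

Lemma image_submod_closed N : submod_closed (image_submod N).
Proof.
split=> [|a x y].
  by apply/image_submodP; exists 0; rewrite ?rpred0 ?linear0.
move=> /image_submodP[u uN ->] /image_submodP[v vN ->].
by apply/image_submodP; exists (a *: u + v); rewrite ?linearP // rpredD ?rpredZ.
Qed.
HB.instance Definition _ N :=
  GRing.isSubmodClosed.Build R V (image_submod N) (image_submod_closed N).

Definition preim_submod X : {pred U} := [pred x | f x \in X].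

Lemma preim_submod_closed X : submod_closed (preim_submod X).
Proof.
split=> [|a x y]; rewrite !inE ?linear0 ?rpred0 // => fx fy.
by rewrite linearP rpredD ?rpredZ.
Qed.
HB.instance Definition _ X :=
  GRing.isSubmodClosed.Build R U (preim_submod X) (preim_submod_closed X).

Lemma mem_image_submod N x : x \in N -> f x \in image_submod N.
Proof. by move=> xN; apply/image_submodP; exists x. Qed.

Lemma mem_image_ker N x : {subset ker_submod f <= N} ->
  f x \in image_submod N -> x \in N.
Proof.
move=> kN /image_submodP[y yN fxy]; rewrite -[x](subrK y) rpredD //.
by apply: kN; rewrite inE linearB fxy subrr.
Qed.

Lemma chain_image n N P : {subset ker_submod f <= N} ->
  chain n N P -> chain n (image_submod N) (image_submod P).
Proof.
elim: n N => [|n IHn] N kN /=.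
  by move=> NP y /image_submodP[x /NP xP ->]; apply: mem_image_submod.
move=> [Q [NQ QN] QP]; exists (image_submod Q : submodClosed V).
  split=> [y /image_submodP[x /NQ xQ ->]|imQN]; first exact: mem_image_submod.
  apply: QN => x xQ; apply: mem_image_ker kN _.
  exact/imQN/mem_image_submod.
by apply: IHn QP => x /kN/NQ.
Qed.

Lemma chain_preim n X Y : {subset Y <= im_submod f} ->
  chain n X Y -> chain n (preim_submod X) (preim_submod Y).
Proof.
move=> Yf; elim: n X => [|n IHn] X /=; first by move=> XY x; apply: XY.
move=> [Z [XZ ZX] ZY]; exists (preim_submod Z : submodClosed U).
  split=> [x /XZ //|pZX]; apply: ZX => z zZ.
  have /asboolP[x zx] := Yf _ (chain_sub ZY zZ).
  by move: zZ; rewrite zx; apply: pZX.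
exact: IHn.
Qed.

(** Correspondence theorem: above the kernel, taking the preimage undoes taking the image, so chains
    can be pulled back as well as pushed forward. *)
Lemma chain_imageE n N P : {subset ker_submod f <= N} -> {subset N <= P} ->
  chain n N P <-> chain n (image_submod N) (image_submod P).
Proof.
move=> kN NP; split=> [|c]; first exact: chain_image.
have : chain n (preim_submod (image_submod N)) (preim_submod (image_submod P)).
  by apply: chain_preim c => y /image_submodP[x _ ->]; apply/asboolP; exists x.
apply: chain_widen => [x xN|x]; first exact: mem_image_submod.
by apply: mem_image_ker => y /kN/NP.
Qed.

End ImagePreimage.

(** * Module length as the length of the interval from zero to the whole module *)

Section ModuleLength.
Context {R : pzRingType}.

Lemma has_chainE (V : lmodType R) n :
  has_chain V n <-> chain n (@zero_submod R V) (@full_submod R V).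
Proof.
split=> [[c cP]|].
  have : chain n (c 0%N) (c n).
    elim: n c cP => [|n IHn] c cP //=; exists (c 1%N); first exact: cP.
    by apply: (IHn (fun i => c i.+1)) => i; apply: (cP i.+1).
  by apply: chain_widen => // x /eqP->; rewrite rpred0.
(* The starting term is fixed as [c 0] so that the induction can prepend a submodule to the
   sequence. *)
suff ex N : chain n N (@full_submod R V) -> exists2 c : nat -> submodClosed V,
    c 0%N = N & forall i, (i < n)%N -> proper_submod (c i) (c i.+1).
  by move=> /ex[c _ cP]; exists c.
elim: n N => [|n IHn] N /=; first by exists (fun=> N).
move=> [Q NQ /IHn[c c0 cP]].
exists (fun i => if i is j.+1 then c j else N) => //.
by case=> [|i] ltin; [rewrite c0|exact: cP].
Qed.

Lemma module_lengthE (V : lmodType R) :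
  fin_len (@zero_submod R V) (@full_submod R V) ->
  module_length V = (len (@zero_submod R V) (@full_submod R V))%:Z%:E.
Proof.
move=> /lenP[//|lc lm]; apply: xget_unique => /=.
  exists (len (@zero_submod R V) (@full_submod R V)) => //.
  by split=> [|m /has_chainE/lm //]; exact/has_chainE.
move=> _ [n [nc nmax] <-]; congr (_%:Z%:E); apply/eqP.
by rewrite eqn_leq lm ?nmax //; exact/has_chainE.
Qed.

End ModuleLength.

(** * Chains in submodules and quotient modules *)

Section SubQuotientChains.
Context {R : pzRingType} {V : lmodType R} (N : submodClosed V).

Lemma chain_submod_type n :
  chain n (@zero_submod R (submod_type N)) full_submod <->
  chain n zero_submod N.
Proof.
pose v : {linear submod_type N -> V} := \val.
have kv : {subset ker_submod v <= zero_submod}.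
  by move=> x; rewrite !inE.
have sv : {subset @zero_submod R (submod_type N) <= full_submod} by [].
apply: iff_trans (chain_imageE n kv sv) _; split; apply: chain_widen.
- move=> _ /eqP->; exact: rpred0.
- by move=> _ /image_submodP[x _ ->]; apply: valP.
- by move=> _ /image_submodP[x /eqP-> ->]; rewrite linear0; apply: rpred0.
- by move=> x xN; apply/image_submodP; exists (Sub x xN).
Qed.

Lemma to_quot_eq0 x : to_quot N x = 0 <-> x \in N.
Proof. by rewrite -[0](linear0 (to_quot N)) to_quot_eq subr0. Qed.

(** The hypothesis makes [P] the preimage of [Q], which also forces [N] inside [P]; the
    correspondence theorem for the projection then applies. *)
Lemma chain_to_quot n (P : submodClosed V) (Q : submodClosed (quot_mod N)) :
  (forall x, to_quot N x \in Q <-> x \in P) ->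
  chain n zero_submod Q <-> chain n N P.
Proof.
move=> QP; pose p : {linear V -> quot_mod N} := to_quot N.
have kp : {subset ker_submod p <= N} by move=> x /eqP/to_quot_eq0.
have NP : {subset N <= P}.
  by move=> x /to_quot_eq0 x0; apply/QP; rewrite x0 rpred0.
apply: iff_trans _ (iff_sym (chain_imageE n kp NP)); split; apply: chain_widen.
- by move=> _ /image_submodP[x xN ->]; apply/eqP/to_quot_eq0.
- by move=> x; rewrite -[x]to_quotK => /QP; apply: mem_image_submod.
- by move=> _ /eqP->; rewrite rpred0.
- by move=> _ /image_submodP[x /QP xQ ->].
Qed.

Lemma chain_quot_above n (P : submodClosed V) (Q : submodClosed (quot_mod N)) :
  (forall x, to_quot N x \in Q <-> x \in P) ->
  chain n Q full_submod <-> chain n P full_submod.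
Proof.
move=> QP; pose p : {linear V -> quot_mod N} := to_quot N.
have kp : {subset ker_submod p <= P}.
  by move=> x /eqP/= x0; apply/QP; rewrite x0 rpred0.
have sP : {subset P <= full_submod} by [].
apply: iff_trans _ (iff_sym (chain_imageE n kp sP)).
split; apply: chain_widen => //.
- by move=> _ /image_submodP[x /QP xQ ->].
- by move=> x _; rewrite -[x]to_quotK; apply: mem_image_submod.
- by move=> x; rewrite -[x]to_quotK => /QP; apply: mem_image_submod.
Qed.

End SubQuotientChains.

(** * The kernel and cokernel modules as intervals of ideals *)

Section KernelCokernelLength.
Context {A : comNzRingType}.
Implicit Types (L N P : ideal A) (a : A).

Definition colon L a : {pred A^o} :=
  preim_submod ( *:%R a : {linear A^o -> A^o}) L.
HB.instance Definition _ L a := GRing.SubmodClosed.on (colon L a).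

Lemma sub_colon L a : {subset L <= colon L a}.
Proof. by move=> x xL; rewrite inE rpredZ. Qed.

Lemma chain_K n a L : chain n (@zero_submod A (K_mod a L)) full_submod <->
  chain n L (colon L a).
Proof.
apply: iff_trans (chain_submod_type _ n) _; apply: chain_to_quot => x.
split=> [/eqP|xL]; first by rewrite /= muE => /to_quot_eq0.
by apply/eqP; rewrite /= muE; apply/to_quot_eq0.
Qed.

(** Two quotients are undone in turn: first by the image of [mu], then by [L]. The preimage of that
    image in [A] is [L + aA]. *)
Lemma chain_C n a L : chain n (@zero_submod A (C_mod a L)) full_submod <->
  chain n (add_submod L (principal a)) full_submod.
Proof.
apply: (@iff_trans _ (chain n (im_submod (@mu A a L)) full_submod)).
  by apply: chain_to_quot.
apply: chain_quot_above => x; split=> [/asboolP[y]|].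
  rewrite -[y]to_quotK /= muE => /to_quot_eq xL.
  apply/add_submodP; exists (x - a * repr y), (a * repr y); split=> //.
    by apply/asboolP; exists (repr y).
  by rewrite subrK.
move=> /add_submodP[y [_ [yL /asboolP[z ->] ->]]].
apply/asboolP; exists (to_quot L z).
by rewrite /= muE to_quotD (to_quot_eq0 _ _).2 // add0r.
Qed.

Lemma module_length_K a L : fin_len L (colon L a) ->
  module_length (K_mod a L) = (len L (colon L a))%:Z%:E.
Proof.
have [finE <-] := len_same_chains (fun n => chain_K n a L).
by move=> /finE; apply: module_lengthE.
Qed.

Lemma module_length_C a L : fin_len (add_submod L (principal a)) full_submod ->
  module_length (C_mod a L) =
    (len (add_submod L (principal a)) full_submod)%:Z%:E.
Proof.
have [finE <-] := len_same_chains (fun n => chain_C n a L).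
by move=> /finE; apply: module_lengthE.
Qed.

End KernelCokernelLength.

(** * Perspective intervals in a modular lattice *)

Section ModularLattice.
Context {R : pzRingType} {V : lmodType R}.
Implicit Types N P Q I J B X Y : submodClosed V.

Lemma subset_trans_mem X Y N :
  {subset X <= Y} -> {subset Y <= N} -> {subset X <= N}.
Proof. by move=> XY YN x /XY/YN. Qed.

Lemma cap_sub_l N P Q : {subset N <= Q} -> {subset cap_submod N P <= Q}.
Proof. exact/subset_trans_mem/cap_subl. Qed.

Lemma cap_sub_r N P Q : {subset P <= Q} -> {subset cap_submod N P <= Q}.
Proof. exact/subset_trans_mem/cap_subr. Qed.

Lemma sub_add_l N P Q : {subset Q <= N} -> {subset Q <= add_submod N P}.
Proof. by move=> QN; apply: subset_trans_mem QN (@add_subl _ _ N P). Qed.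

Lemma sub_add_r N P Q : {subset Q <= P} -> {subset Q <= add_submod N P}.
Proof. by move=> QP; apply: subset_trans_mem QP (@add_subr _ _ N P). Qed.

(** Backtracking search for inclusions valid in every lattice, given the hypotheses at its leaves.
    Inclusions that need modularity are supplied through [modular_le]. *)
Ltac lat := solve [ assumption | exact: (fun x => id)
  | apply: sub_cap; lat | apply: add_sub; lat
  | apply: cap_sub_l; lat | apply: cap_sub_r; lat
  | apply: sub_add_l; lat | apply: sub_add_r; lat ].

Lemma modular_sub N P Q : {subset N <= Q} ->
  {subset cap_submod (add_submod N P) Q <= add_submod N (cap_submod P Q)}.
Proof. by move=> NQ x; rewrite modular_law. Qed.

Lemma modular_le N P Q X Y : {subset N <= Q} ->
  {subset X <= cap_submod (add_submod N P) Q} ->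
  {subset add_submod N (cap_submod P Q) <= Y} -> {subset X <= Y}.
Proof. by move=> NQ XN NY x /XN/(modular_sub NQ)/NY. Qed.

(** The inclusions amount to [N = P \cap X] and [Y = P + X]. Stating them separately lets the
    endpoints be any expressions and leaves goals suited to [lat]. *)
Lemma chain_perspective n N P X Y :
  {subset N <= X} -> {subset cap_submod P X <= N} -> {subset N <= P} ->
  {subset X <= Y} -> {subset Y <= add_submod P X} -> {subset P <= Y} ->
  chain n N P <-> chain n X Y.
Proof.
move=> NX PXN NP XY YPX PY; split=> c.
  have : chain n X (add_submod P X).
    by apply/chain_transpose; apply: chain_widen c.
  by apply: chain_widen => //; lat.
have : chain n (cap_submod P X) P.
  by apply/chain_transpose; apply: chain_widen c.
by apply: chain_widen => //; lat.
Qed.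

(** Each of the four intervals is cut in two: at [(P \cap Q) + I], [(I \cap Q) + J], [I \cap Q] and
    [I + Q]. The pieces of [[I, P]] and [[J, Q]] are then perspective to those of the other two
    intervals. *)
Lemma len_square I P J Q : {subset I <= P} -> {subset J <= Q} ->
  fin_len I P -> fin_len J Q ->
  (len I P + len J Q = len (cap_submod I J) (cap_submod P Q) +
                       len (add_submod I J) (add_submod P Q))%N.
Proof.
move=> IP JQ fP fQ.
have [f1 e1] : (fin_len (cap_submod I J) (cap_submod I Q) <->
    fin_len J (add_submod (cap_submod I Q) J)) /\
    len (cap_submod I J) (cap_submod I Q) =
    len J (add_submod (cap_submod I Q) J).
  by apply: len_same_chains => n; apply: chain_perspective; lat.
have [f2 e2] : (fin_len (cap_submod I Q) (cap_submod P Q) <->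
    fin_len I (add_submod (cap_submod P Q) I)) /\
    len (cap_submod I Q) (cap_submod P Q) =
    len I (add_submod (cap_submod P Q) I).
  by apply: len_same_chains => n; apply: chain_perspective; lat.
have [f3 e3] : (fin_len (add_submod (cap_submod I Q) J) Q <->
    fin_len (add_submod I J) (add_submod I Q)) /\
    len (add_submod (cap_submod I Q) J) Q =
    len (add_submod I J) (add_submod I Q).
  apply: len_same_chains => n; apply: chain_perspective; try lat.
  by apply: (@modular_le J I Q); lat.
have [f4 e4] : (fin_len (add_submod (cap_submod P Q) I) P <->
    fin_len (add_submod I Q) (add_submod P Q)) /\
    len (add_submod (cap_submod P Q) I) P =
    len (add_submod I Q) (add_submod P Q).
  apply: len_same_chains => n; apply: chain_perspective; try lat.
  by apply: (@modular_le I Q P); lat.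
rewrite (@len_add _ _ I (add_submod (cap_submod P Q) I) P) //; try lat.
rewrite (@len_add _ _ J (add_submod (cap_submod I Q) J) Q) //; try lat.
rewrite (@len_add _ _ (cap_submod I J) (cap_submod I Q)) //; try lat.
  rewrite (@len_add _ _ (add_submod I J) (add_submod I Q)) //; try lat.
    by rewrite e1 e2 e3 e4; lia.
  apply: (@fin_len_trans _ _ _ (add_submod I Q)); try lat.
    by apply/f3; apply: fin_len_sub fQ; lat.
  by apply/f4; apply: fin_len_sub fP; lat.
apply: (@fin_len_trans _ _ _ (cap_submod I Q)); try lat.
  by apply/f1; apply: fin_len_sub fQ; lat.
by apply/f2; apply: fin_len_sub fP; lat.
Qed.

(* Three perspectivities of the modular lattice generated by I, J and B. *)
Lemma chain_cross n I J B :
  chain n (add_submod (cap_submod B I) (cap_submod B J))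
          (cap_submod B (add_submod I J)) <->
  chain n (add_submod B (cap_submod I J))
          (cap_submod (add_submod B I) (add_submod B J)).
Proof.
(* Adding [J] to both ends of the first interval gives [[X, Y]]. *)
pose X : submodClosed V := add_submod (cap_submod B I) J.
pose Y : submodClosed V := cap_submod (add_submod B J) (add_submod I J).
apply: (@iff_trans _ (chain n X Y)); rewrite /X /Y.
  apply: chain_perspective; try lat.
    by apply: (@modular_le (cap_submod B I) J B); lat.
  by apply: (@modular_le J B (add_submod I J)); lat.
(* Intersecting both ends of [[X, Y]] with [I] gives this interval, and adding [B] to it gives the
   target. *)
apply: (@iff_trans _ (chain n (add_submod (cap_submod B I) (cap_submod I J))
                              (cap_submod I (add_submod B J)))).
  apply: iff_sym; apply: chain_perspective; try lat.
    by apply: (@modular_le (cap_submod B I) J I); lat.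
  by apply: (@modular_le J I (add_submod B J)); lat.
apply: chain_perspective; try lat.
  by apply: (@modular_le (cap_submod I J) B I); lat.
by apply: (@modular_le B I (add_submod B J)); lat.
Qed.

End ModularLattice.

(** * The length formula in terms of ideal intervals *)

Section LengthOfKernels.
Context {A : comNzRingType}.
Implicit Types (I J L : ideal A) (a : A).

Lemma mem_principal a x : a * x \in principal a.
Proof. by apply/asboolP; exists x. Qed.

Lemma mem_colon L a x : (x \in colon L a) = (a * x \in L).
Proof. by []. Qed.

Lemma colon_mono I J a : {subset I <= J} -> {subset colon I a <= colon J a}.
Proof. by move=> IJ x; rewrite !mem_colon => /IJ. Qed.

(* Multiplication by a, whose kernel lies in every colon ideal, carries the
   left-hand interval onto the right-hand one. *)
Lemma chain_colon n I J a :
  chain n (add_submod (colon I a) (colon J a)) (colon (add_submod I J) a) <->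
  chain n (add_submod (cap_submod (principal a) I) (cap_submod (principal a) J))
          (cap_submod (principal a) (add_submod I J)).
Proof.
pose f : {linear A^o -> A^o} := *:%R a.
have kf : {subset ker_submod f <= add_submod (colon I a) (colon J a)}.
  move=> x /eqP fx; apply: add_subl.
  by rewrite mem_colon [a * x]fx; apply: rpred0.
have sf : {subset add_submod (colon I a) (colon J a)
             <= colon (add_submod I J) a}.
  by apply: add_sub; apply: colon_mono; [apply: add_subl|apply: add_subr].
apply: iff_trans (chain_imageE n kf sf) _; split; apply: chain_widen.
- move=> _ /add_submodP[_ [_ [/andP[/asboolP[x ->] xI]
                            /andP[/asboolP[y ->] yJ] ->]]].
  rewrite -mulrDr -[a * _]/(f _).
  by apply: mem_image_submod; apply: mem_add_submod.
- move=> _ /image_submodP[x xS ->].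
  by rewrite mem_cap_submod mem_principal.
- move=> _ /image_submodP[_ /add_submodP[x [y [xI yJ ->]]] ->].
  by rewrite linearD mem_add_submod // mem_cap_submod mem_principal.
- move=> _ /andP[/asboolP[x ->] xS]; rewrite -[a * _]/(f _).
  exact: mem_image_submod.
Qed.

(** The negative terms are moved across the equation, since subtraction in [nat] is truncated. *)
Lemma len_kernel_cokernel I J a (N := cap_submod I J : ideal A)
    (S := add_submod I J : ideal A) :
  (forall L, {subset N <= L} -> fin_len L (colon L a)) ->
  (forall L, {subset N <= L} ->
    fin_len (add_submod L (principal a)) full_submod) ->
  let k L := len L (colon L a) in
  let c L := len (add_submod L (principal a)) full_submod in
  (k N + c I + c J + k S = k I + k J + c N + c S)%N.
Proof.
move=> finK finC k c.
set B : ideal A := principal a.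
pose PQ : ideal A := add_submod (colon I a) (colon J a).
pose D : ideal A := cap_submod (add_submod I B) (add_submod J B).
have NI : {subset N <= I} by apply: cap_subl.
have NJ : {subset N <= J} by apply: cap_subr.
have IS : {subset I <= S} by apply: add_subl.
have JS : {subset J <= S} by apply: add_subr.
have NS : {subset N <= S} by move=> x /NI/IS.
have sqK : (k I + k J = k N + len S PQ)%N.
  rewrite (len_square (@sub_colon _ I a) (@sub_colon _ J a)) //;
    try exact: finK.
  (* The colon of an intersection is the intersection of the colons. *)
  by congr (_ + _)%N; apply: len_congr.
have sqC : (c I + c J = len D full_submod + c S)%N.
  rewrite (len_square _ _ (finC I NI) (finC J NJ)) //.
  congr (_ + _)%N; first exact: len_congr.
  (* The sum of [I + B] and [J + B] is [S + B]. *)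
  apply: len_congr; apply: sub_eqi => //.
  - by apply: add_sub; apply: add_submodS.
  - apply: add_sub; last exact/sub_add_l/add_subr.
    by apply: add_submodS; apply: add_subl.
  - exact: add_subl.
have kS : k S = (len S PQ + len PQ (colon S a))%N.
  apply: len_add; last exact: finK.
    by apply: add_submodS; apply: sub_colon.
  by apply: add_sub; apply: colon_mono.
have cN : c N = (len (add_submod N B) D + len D full_submod)%N.
  apply: len_add => //; last exact: finC.
  by apply: sub_cap; apply: add_submodS.
have eK : len PQ (colon S a) = len (add_submod N B) D.
  rewrite (len_same_chains (fun n => chain_colon n I J a)).2.
  rewrite (len_same_chains (fun n => chain_cross n I J B)).2.
  apply: len_congr => x; first by rewrite add_submodC.
  by rewrite !mem_cap_submod !(add_submodC B).
lia.
Qed.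

End LengthOfKernels.

(** * Finite length from nilpotent action of the maximal ideal *)

Section FiniteLength.
Context {A : comNzRingType}.
Implicit Types (L M X Y : ideal A) (g : A).

Definition span (s : seq A) : ideal A :=
  foldr (fun g N => add_submod (principal g) N) zero_submod s.

Lemma mem_span s g : g \in s -> g \in span s.
Proof.
elim: s => //= h s IHs; rewrite inE => /predU1P[->|/IHs gs].
  by apply: add_subl; rewrite -[X in X \in _]mulr1 mem_principal.
exact: add_subr.
Qed.

Lemma noetherian_span L : noetherian A -> exists s, L =i span s.
Proof.
move=> /(_ L)[n [g Lg]]; exists [seq g i | i <- enum 'I_n].
apply: sub_eqi => x.
  move=> /Lg[c ->]; apply: rpred_sum => i _; apply: rpredZ.
  by apply: mem_span; apply/map_f/mem_enum.
have gL i : g i \in L.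
  apply/Lg; exists (fun j => (j == i)%:R); rewrite (bigD1 i) //= eqxx mul1r.
  by rewrite big1 ?addr0 // => j /negPf->; rewrite mul0r.
suff : {subset span [seq g i | i <- enum 'I_n] <= L} by apply.
elim: (enum _) => [|i s IHs] /=; first by move=> _ /eqP->; rewrite rpred0.
apply: add_sub => // _ /asboolP[y ->]; rewrite mulrC; exact: (@rpredZ _ _ L y).
Qed.

(* An ideal strictly between Y and Y + gA would contain, modulo Y, some g b with b
   outside M; as b is invertible modulo M and M g lies in Y, it would contain g. *)
Lemma fin_len_simple M Y g : maximal_ideal M ->
  (forall m, m \in M -> m * g \in Y) ->
  fin_len Y (add_submod Y (principal g)).
Proof.
(* A chain with at least two strict steps passes through [Y < Z < W], with [W] inside [Y + gA]. *)
move=> [oneM maxM] MgY; exists 1%N => -[//|[//|n]] /=.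
move=> [Z [YZ ZY] [W [ZW WZ] /chain_sub WX]].
exfalso.
have [z zZ zY] : exists2 z, z \in Z & z \notin Y.
  by apply: contrapT => h; apply: ZY => z zZ; apply: contrapT => /negP zY;
    apply: h; exists z.
have /add_submodP[y [_ [yY /asboolP[b ->] zE]]] := WX z (ZW z zZ).
have bM : b \notin M.
  by apply: contra zY => /MgY bgY; rewrite zE rpredD // mulrC.
have /add_submodP[m [_ [mM /asboolP[c ->] oneE]]] :
    (1 : A) \in add_submod M (principal b).
  apply: contraT => /maxM h; move/negP: bM; case; apply: h.
    exact: add_subl.
  by apply: add_subr; rewrite -[X in X \in _]mulr1 mem_principal.
have gZ : g \in Z.
  (* Multiply [1 = m + b c] by [g] and use [z - y = g b]. *)
  have -> : g = m * g + c * (z - y).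
    by rewrite zE addrAC subrr add0r -[LHS]mul1r oneE; ring.
  apply: (@rpredD _ Z); first exact/YZ/MgY.
  by apply: (@rpredZ _ _ Z c); apply: submodB => //; apply: YZ.
apply: WZ => w /WX; apply: add_sub => // _ /asboolP[d ->].
by rewrite mulrC (@rpredZ _ _ Z d).
Qed.

(** Here [X/Y] is a finitely generated vector space over [A/M]; adjoining the generators to [Y] one
    at a time makes each step simple or trivial. *)
Lemma fin_len_killed M Y X : noetherian A -> maximal_ideal M ->
  {subset Y <= X} -> (forall m x, m \in M -> x \in X -> m * x \in Y) ->
  fin_len Y X.
Proof.
move=> noethA maxM YX MXY; have [s Xs] := noetherian_span X noethA.
(* Unlike [X =i span s], this survives moving a generator from [s] into [Y]. *)
have {Xs} : {subset X <= add_submod Y (span s)} /\ {in s, forall g, g \in X}.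
  split=> [x|g /mem_span]; last by rewrite Xs.
  by rewrite Xs; apply: add_subr.
elim: s Y YX MXY => [|g s IHs] Y YX MXY [XY sX].
  exists 0%N => m /chain_same -> // x /XY.
  by apply: add_sub => // _ /eqP->; rewrite rpred0.
have gX : {subset principal g <= X}.
  move=> _ /asboolP[y ->]; rewrite mulrC (@rpredZ _ _ X y) //.
  by apply: sX; rewrite mem_head.
apply: (@fin_len_trans _ _ _ (add_submod Y (principal g))).
- exact: add_subl.
- exact: add_sub.
- apply: fin_len_simple maxM _ => m mM; apply: MXY => //.
  by apply: sX; rewrite mem_head.
apply: IHs; first exact: add_sub.
  by move=> m x mM xX; apply: add_subl; apply: MXY.
split=> [x /XY|h hs]; last by apply: sX; rewrite inE hs orbT.
apply: add_sub; first exact/sub_add_l/add_subl.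
by apply: add_sub; [exact/sub_add_l/add_subr|exact: add_subr].
Qed.

(** The exponent may depend on [m], which is the form a radical provides; finitely many generators
    of [M] suffice to reduce to [fin_len_killed]. *)
Lemma fin_len_nilpotent M Y X : noetherian A -> maximal_ideal M ->
  {subset Y <= X} ->
  (forall m, m \in M -> exists e, forall x, x \in X -> m ^+ e * x \in Y) ->
  fin_len Y X.
Proof.
move=> noethA maxM YX nilM; have [n [g Mg]] := noethA M.
have gM i : g i \in M.
  apply/Mg; exists (fun j => (j == i)%:R); rewrite (bigD1 i) //= eqxx mul1r.
  by rewrite big1 ?addr0 // => j /negPf->; rewrite mul0r.
have {nilM} nil_g i : exists e, forall x, x \in X -> g i ^+ e * x \in Y.
  exact: nilM.
(* The list [s] holds the generators not yet known to map [X'] into [Y']. The induction on [s]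
   contains one on the exponent of its head. *)
suff fin (s : seq 'I_n) (Y' X' : ideal A) : {subset Y' <= X'} ->
    (forall i, exists e, forall x, x \in X' -> g i ^+ e * x \in Y') ->
    (forall i, i \notin s -> forall x, x \in X' -> g i * x \in Y') ->
    fin_len Y' X'.
  by apply: (fin (enum 'I_n)) => // i; rewrite mem_enum.
elim: s Y' X' {Y X YX nil_g} => [|i s IHs] Y X YX nil_g kill_g.
  apply: fin_len_killed noethA maxM YX _ => _ x /Mg[c ->] xX.
  rewrite mulr_suml; apply: rpred_sum => i _.
  by rewrite -mulrA (@rpredZ _ _ Y (c i)) // kill_g.
have [e] := nil_g i.
elim: e X YX nil_g kill_g => [|e IHe] X YX nil_g kill_g nil_i.
  by exists 0%N => m /chain_same -> // x /nil_i; rewrite mul1r.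
(* Cut at [Y + g_i X]: below it the exponent of [g i] drops by one, and above it [g i] acts as zero,
   so [i] leaves the list. *)
pose giX : ideal A := image_submod ( *:%R (g i) : {linear A^o -> A^o}) X.
pose X' : ideal A := add_submod Y giX.
have X'X : {subset X' <= X}.
  apply: add_sub => // _ /image_submodP[x xX ->]; exact: rpredZ.
have YX' : {subset Y <= X'} by apply: add_subl.
apply: (@fin_len_trans _ _ _ X') => //.
  apply: IHe => //.
  - by move=> j; have [d nil_j] := nil_g j; exists d => x /X'X; apply: nil_j.
  - by move=> j /kill_g kill_j x /X'X; apply: kill_j.
  - move=> _ /add_submodP[y [_ [yY /image_submodP[x xX ->] ->]]].
    rewrite mulrDr; apply: (@rpredD _ Y).
      exact: (@rpredZ _ _ Y (g i ^+ e)).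
    by rewrite mulrA -exprSr; apply: nil_i.
apply: IHs => // j.
  by have [d nil_j] := nil_g j; exists d => x xX; apply: YX'; apply: nil_j.
move=> js x xX; have [ji|ji] := eqVneq j i.
  by rewrite ji; apply: add_subr; apply/image_submodP; exists x.
by apply: YX'; apply: kill_g => //; rewrite inE negb_or ji.
Qed.

End FiniteLength.

(** Lengths are extended integers, so the finiteness of all eight is part of the conclusion: it
    ensures that the differences are genuine. *)
Theorem proposition3p6 (A : comNzRingType) (M I J : ideal A) (a : A)
  (noethA : noetherian A) (localA : local_ring M)
  (primIJa : primary_to M (add_submod (cap_submod I J) (principal a))) :
  [/\ (module_length (K_mod a (cap_submod I J)) < +oo)%E,
      (module_length (K_mod a I) < +oo)%E,
      (module_length (K_mod a J) < +oo)%E &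
      (module_length (K_mod a (add_submod I J)) < +oo)%E] /\
  [/\ (module_length (C_mod a (cap_submod I J)) < +oo)%E,
      (module_length (C_mod a I) < +oo)%E,
      (module_length (C_mod a J) < +oo)%E &
      (module_length (C_mod a (add_submod I J)) < +oo)%E] /\
  (module_length (K_mod a (cap_submod I J)) - module_length (K_mod a I)
     - module_length (K_mod a J) + module_length (K_mod a (add_submod I J))
   = module_length (C_mod a (cap_submod I J)) - module_length (C_mod a I)
     - module_length (C_mod a J) + module_length (C_mod a (add_submod I J)))%E.
Proof.
have [maxM _] := localA; have [_ radM] := primIJa.
pose N : ideal A := cap_submod I J.
have nilN m (L : ideal A) : {subset N <= L} -> m \in M ->
    exists e, m ^+ e \in add_submod L (principal a).
  move=> NL /radM[e me]; exists e.+1; move: me; exact: add_submodS.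
(* Write [m ^+ e = y + a z] with [y] in [L]. If [a x] is in [L], then so is
   [m ^+ e x = y x + z (a x)]. *)
have finK (L : ideal A) : {subset N <= L} -> fin_len L (colon L a).
  move=> NL; apply: fin_len_nilpotent noethA maxM (@sub_colon _ L a) _ => m.
  move=> /(nilN _ _ NL)[e /add_submodP[y [_ [yL /asboolP[z ->] mE]]]].
  exists e => x xLa; rewrite mE mulrDl; apply: (@rpredD _ L).
    by rewrite mulrC; apply: (@rpredZ _ _ L x).
  by rewrite mulrAC mulrC; apply: (@rpredZ _ _ L z).
have finC (L : ideal A) : {subset N <= L} ->
    fin_len (add_submod L (principal a)) full_submod.
  move=> NL; apply: fin_len_nilpotent noethA maxM _ _ => // m.
  move=> /(nilN _ _ NL)[e me]; exists e => x _; rewrite mulrC.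
  exact: (@rpredZ _ _ (add_submod L (principal a)) x).
have NN : {subset N <= N} by [].
have NI : {subset N <= I} by apply: cap_subl.
have NJ : {subset N <= J} by apply: cap_subr.
have NS : {subset N <= add_submod I J} by apply/sub_add_l/cap_subl.
rewrite !module_length_K ?module_length_C; try (exact: finK || exact: finC).
split; first by split; exact: ltry.
split; first by split; exact: ltry.
have := len_kernel_cokernel finK finC.
(* All values being finite, the equation descends to the integers, where it is a rearrangement of
   [E]. *)
move=> /= E; rewrite -!EFinB -!EFinD; congr EFin; move: E; lia.
Qed.
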